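(* Let $\alpha=\sqrt[3]{16}$, let $K=\mathbb{Q}(\alpha)=\mathbb{Q}(\sqrt[3]{2})$ (the field of fractions of $\mathbb{Z}[\alpha]$), and let $$A=\begin{pmatrix}0 & 2 & \alpha\\ 2\alpha & 0 & 4\\ 4 & \alpha & 0\end{pmatrix}\in \mathrm{M}_3(\mathbb{Z}[\alpha]).$$ Then $A$ is not $K$-similar to any matrix in $\mathrm{M}_3(\mathbb{Z}[\alpha])$ with diagonal $(1,-1,0)$. Thus the following assertion fails for $R=\mathbb{Z}[\alpha]$: ''for every $n\geq 2$, every non-scalar $C\in \mathrm{M}_n(R)$ and all $\gamma_1,\dots,\gamma_n\in R$ such that $\gamma_1+\dots+\gamma_n=\mathrm{Tr}(C)$, there exists a matrix $B\in \mathrm{M}_n(R)$ with diagonal $(\gamma_1,\dots,\gamma_n)$ such that $C$ is similar to $B$ over the field of fractions of $R$''. Moreover, $A$ is not $K$-similar to any matrix in $\mathrm{M}_3(\mathbb{Z}[\alpha])$ that has an off-diagonal entry equal to $1$.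
   Context: $\mathrm{M}_n(R)$ denotes the ring of $n\times n$ matrices over $R$. For a commutative ring $S$, two matrices $A,B\in \mathrm{M}_n(S)$ are called $S$-similar (similar over $S$) if there exists $g\in \mathrm{GL}_n(S)$ such that $gAg^{-1}=B$; matrices over $\mathbb{Z}[\alpha]$ are regarded as matrices over $K$ when speaking of $K$-similarity. Here $\sqrt[3]{16}$ and $\sqrt[3]{2}$ denote the real cube roots. A matrix is scalar if it equals $\lambda I_n$ for some $\lambda$ in the ring. *)

(* Defs.v *)
From HB Require Import structures.
From mathcomp Require Import all_boot all_order all_algebra all_field.
From mathcomp Require Import boolp.

Set Implicit Arguments.
Unset Strict Implicit.
Unset Printing Implicit Defensive.

Import Order.TTheory GRing.Theory Num.Theory.
Local Open Scope ring_scope.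

(* Over a field this is A ~_{in unitmx} B of mxpoly, but S may be any ring. *)
Definition similar (S : comUnitRingType) (n : nat) (A B : 'M[S]_n) : Prop :=
  exists2 g : 'M[S]_n, g \in unitmx & g *m A *m invmx g = B.

Definition has_diagonal (S : Type) (n : nat) (B : 'M[S]_n) (d : 'I_n -> S) :=
  forall i, B i i = d i.

Definition prescribed_diagonals (R : idomainType) : Prop :=
  forall (n : nat) (C : 'M[R]_n) (gamma : 'I_n -> R),
    (2 <= n)%N -> ~~ is_scalar_mx C -> \sum_i gamma i = \tr C ->
    exists B : 'M[R]_n, has_diagonal B gamma /\
      similar (map_mx (@tofrac R) C) (map_mx (@tofrac R) B).

(* Z[a] inside algC, as values at a of integer polynomials; membership is made
   boolean classically so that Z[a] can be a subtype with its own ring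
   structure. *)
Section ZAdjoin.
Variable a : algC.

Definition Zadjoin : {pred algC} :=
  fun x => `[< exists p : {poly int}, x = (map_poly intr p).[a] >].

Lemma ZadjoinP x :
  reflect (exists p : {poly int}, x = (map_poly intr p).[a]) (x \in Zadjoin).
Proof. exact: asboolP. Qed.

Fact Zadjoin_subring : subring_closed Zadjoin.
Proof.
split=> [|_ _ /ZadjoinP[p ->] /ZadjoinP[q ->]
         |_ _ /ZadjoinP[p ->] /ZadjoinP[q ->]]; apply/ZadjoinP.
- by exists 1; rewrite rmorph1 hornerC.
- by exists (p - q); rewrite rmorphB !hornerE.
- by exists (p * q); rewrite rmorphM !hornerE.
Qed.

HB.instance Definition _ :=
  GRing.isSubringClosed.Build algC Zadjoin Zadjoin_subring.

Record Zadj := ZAdj { Zadj_val : algC; _ : Zadj_val \in Zadjoin }.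
HB.instance Definition _ := [isSub for Zadj_val].
HB.instance Definition _ := [Choice of Zadj by <:].
HB.instance Definition _ := [SubChoice_isSubComNzRing of Zadj by <:].

(* Inversion is that of algC, on the elements whose inverse lies in Z[a]. *)
Definition Zadj_unit : pred Zadj :=
  fun x => (x != 0) && ((\val x)^-1 \in Zadjoin).
Definition Zadj_inv (x : Zadj) : Zadj := insubd x (\val x)^-1.

Fact Zadj_mulVx : {in Zadj_unit, left_inverse 1 Zadj_inv *%R}.
Proof.
move=> x /andP[nz_x Vx]; apply: val_inj; rewrite rmorphM rmorph1 /=.
by rewrite insubdK // mulVf // -(rmorph0 (\val : Zadj -> algC)) (inj_eq val_inj).
Qed.

Fact Zadj_unitPl (x y : Zadj) : y * x = 1 -> Zadj_unit x.
Proof.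
move=> yx1; have /(congr1 \val) := yx1; rewrite rmorphM rmorph1 /= => vyx.
apply/andP; split.
  by apply/eqP=> x0; move/eqP: yx1; rewrite x0 mulr0 eq_sym oner_eq0.
suff <- : \val y = (\val x)^-1 by exact: valP.
have nz : \val x != 0.
  by apply: contra_eq_neq vyx => ->; rewrite mulr0 eq_sym oner_eq0.
by apply: (mulIf nz); rewrite vyx mulVf.
Qed.

Fact Zadj_inv_out : {in [predC Zadj_unit], Zadj_inv =1 id}.
Proof.
move=> x; rewrite inE /= negb_and negbK => /orP[/eqP->|Vx].
  by apply: val_inj; rewrite /Zadj_inv rmorph0 invr0 insubdK ?rpred0.
by apply: val_inj; rewrite val_insubd (negPf Vx).
Qed.

HB.instance Definition _ := GRing.ComNzRing_hasMulInverse.Build Zadj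
  Zadj_mulVx Zadj_unitPl Zadj_inv_out.
HB.instance Definition _ := [SubComUnitRing_isSubIntegralDomain of Zadj by <:].

Fact Zadjoin_gen : a \in Zadjoin.
Proof. by apply/ZadjoinP; exists 'X; rewrite map_polyX hornerX. Qed.

Definition Zgen : Zadj := ZAdj Zadjoin_gen.

End ZAdjoin.

(* Q(a) inside algC, as values at a of rational fractions. *)
Section QAdjoin.
Variable a : algC.

Definition Qadjoin : {pred algC} :=
  fun x => `[< exists p q : {poly rat}, (map_poly ratr q).[a] != 0 /\
                 x = (map_poly ratr p).[a] / (map_poly ratr q).[a] >].

Lemma QadjoinP x :
  reflect (exists p q : {poly rat}, (map_poly ratr q).[a] != 0 /\
             x = (map_poly ratr p).[a] / (map_poly ratr q).[a])
    (x \in Qadjoin).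
Proof. exact: asboolP. Qed.

Fact Qadjoin_divring : divring_closed Qadjoin.
Proof.
split=> [|_ _ /QadjoinP[p [q [nz ->]]] /QadjoinP[r [s [nz' ->]]]
         |_ _ /QadjoinP[p [q [nz ->]]] /QadjoinP[r [s [nz' ->]]]];
  apply/QadjoinP.
- by exists 1, 1; rewrite rmorph1 hornerC divr1 oner_eq0.
- exists (p * s - r * q), (q * s); rewrite rmorphB !rmorphM !hornerE mulf_neq0 //.
  by split=> //; rewrite -mulNr addf_div // mulNr.
- have [r0|nzr] := eqVneq (map_poly ratr r).[a] 0.
    exists 0, 1; rewrite rmorph0 rmorph1 !hornerE oner_eq0 r0.
    by split=> //; rewrite mul0r invr0 mulr0.
  exists (p * s), (q * r); rewrite !rmorphM !hornerE mulf_neq0 //.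
  by split=> //; rewrite invf_div mulf_div.
Qed.

HB.instance Definition _ :=
  GRing.isDivringClosed.Build algC Qadjoin Qadjoin_divring.

Record Qadj := QAdj { Qadj_val : algC; _ : Qadj_val \in Qadjoin }.
HB.instance Definition _ := [isSub for Qadj_val].
HB.instance Definition _ := [Choice of Qadj by <:].
HB.instance Definition _ := [SubChoice_isSubComUnitRing of Qadj by <:].
HB.instance Definition _ := [SubComUnitRing_isSubIntegralDomain of Qadj by <:].
HB.instance Definition _ := [SubIntegralDomain_isSubField of Qadj by <:].

Fact Zadjoin_sub_Qadjoin : {subset Zadjoin a <= Qadjoin}.
Proof.
move=> _ /ZadjoinP[p ->]; apply/QadjoinP; exists (map_poly intr p), 1.
rewrite rmorph1 hornerC oner_eq0 divr1 -map_poly_comp; split=> //.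
by congr (_.[a]); apply: eq_map_poly => z /=; rewrite ratr_int.
Qed.

Definition ZtoQ (x : Zadj a) : Qadj := QAdj (Zadjoin_sub_Qadjoin (valP x)).

Fact ZtoQ_is_zmod_morphism : zmod_morphism ZtoQ.
Proof.
move=> x y; apply: val_inj; rewrite rmorphB.
exact: (rmorphB (\val : Zadj a -> algC)).
Qed.

Fact ZtoQ_is_monoid_morphism : monoid_morphism ZtoQ.
Proof.
split=> [|x y]; apply: val_inj; first by rewrite rmorph1.
by rewrite rmorphM; exact: (rmorphM (\val : Zadj a -> algC)).
Qed.

HB.instance Definition _ :=
  GRing.isZmodMorphism.Build (Zadj a) Qadj ZtoQ ZtoQ_is_zmod_morphism.
HB.instance Definition _ :=
  GRing.isMonoidMorphism.Build (Zadj a) Qadj ZtoQ ZtoQ_is_monoid_morphism.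

End QAdjoin.

(* 3.-root is a root of minimal argument, so it is real on nonnegative reals. *)
Definition alpha : algC := 3.-root 16.

Lemma alpha_ge0 : 0 <= alpha.
Proof. by rewrite rootC_ge0 ?ler0n. Qed.

Lemma alphaX3 : alpha ^+ 3 = 16.
Proof. exact: rootCK. Qed.

Notation Zalpha := (Zadj alpha).
Notation Qalpha := (Qadj alpha).

Definition matA : 'M[Zalpha]_3 :=
  let a := Zgen alpha in
  \matrix_(i, j) (nth [::] [:: [:: 0;     2; a];
                               [:: 2 * a; 0; 4];
                               [:: 4;     a; 0] ] i)`_j.

Definition diag_1N10 (i : 'I_3) : Zalpha := [:: 1; -1; 0]`_i.

Definition similar_over_K (n : nat) (C D : 'M[Zalpha]_n) : Prop :=
  similar (map_mx (@ZtoQ alpha) C) (map_mx (@ZtoQ alpha) D).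

(* Main.v *)
(* Put s = alpha^2 / 2.  Then A + s I has rank one, hence so has N = B + s I
   for every matrix B similar to A over a field containing Z[alpha], and all
   2 x 2 minors of N vanish.  If B has diagonal (1, -1, 0), then
   N_13 N_31 = (1 + s) s = s + 4 alpha; if B_ij = 1 with i, j, k distinct, then
   N_kk = N_kk N_ij = N_kj N_ik.  Either way s lies in Z[alpha], which
   contradicts the linear independence of 1, 2^(1/3), 2^(2/3). *)
Require Import Defs.
From HB Require Import structures.
From mathcomp Require Import all_boot all_order all_algebra all_field.
From mathcomp Require Import ring zify.

Import Order.TTheory GRing.Theory Num.Theory.
Local Open Scope ring_scope.

(** * The field K: its two generators, and its elements as fractions over Z[alpha] *)

Lemma alphaE : alpha = 2 * 3.-root 2.
Proof.
have e8 : 3.-root 8 = 2 :> algC.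
  have -> : 8 = 2 ^+ 3 :> algC by rewrite -natrX.
  by rewrite exprCK ?ler0n.
by rewrite /alpha -{1}e8 -rootCMl ?ler0n // -natrM.
Qed.

(** Substituting [d%:P * 'X] in numerator and denominator turns values at [ratr d * b] into values
    at [b]; the converse is the same with [c^-1]. *)
Lemma Qadjoin_scale (c : rat) (a x : algC) : c != 0 ->
  (x \in Qadjoin (ratr c * a)) = (x \in Qadjoin a).
Proof.
have sub (d : rat) (b y : algC) : y \in Qadjoin (ratr d * b) -> y \in Qadjoin b.
  have evalE (p : {poly rat}) : (map_poly ratr p).[ratr d * b] =
      (map_poly ratr (p \Po (d%:P * 'X))).[b].
    by rewrite map_comp_poly horner_comp rmorphM /= map_polyC map_polyX !hornerE.
  case/QadjoinP=> p [q [nz ->]]; apply/QadjoinP.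
  by exists (p \Po (d%:P * 'X)), (q \Po (d%:P * 'X)); rewrite -!evalE.
move=> nz_c; apply/idP/idP; first exact: sub.
have {1}-> : a = ratr c^-1 * (ratr c * a).
  by rewrite mulrA -rmorphM mulVf // rmorph1 mul1r.
exact: sub.
Qed.

Lemma Qadj_fraction (a : algC) (z : Qadj a) :
  exists x y : Zadj a, y != 0 /\ z = ZtoQ x / ZtoQ y.
Proof.
have Zval (p : {poly int}) : (map_poly intr p).[a] \in Zadjoin a.
  by apply/ZadjoinP; exists p.
have clear_den (p : {poly rat}) : exists (r : {poly int}) (c : int),
    c != 0 /\ (map_poly ratr p).[a] = (map_poly intr r).[a] / c%:~R.
  have [r [c nz_c ->]] := rat_poly_scale p.
  exists r, c; split=> //; rewrite map_polyZ hornerE /= mulrC.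
  have -> : ratr c%:~R^-1 = c%:~R^-1 :> algC by rewrite fmorphV /= ratr_int.
  congr (_.[_] / _); rewrite -map_poly_comp.
  by apply: eq_map_poly => m /=; rewrite ratr_int.
have [p [q [nz_q zE]]] := QadjoinP _ _ (valP z).
have [r [c [nz_c pE]]] := clear_den p; have [s [d [nz_d qE]]] := clear_den q.
have nzC (m : int) : m != 0 -> m%:~R != 0 :> algC by rewrite intr_eq0.
have nz_s : (map_poly intr s).[a] != 0.
  by apply: contra_neq nz_q => s0; rewrite qE s0 mul0r.
(* Cross-multiplied denominators: (r(a) / c) / (s(a) / d) = d r(a) / (c s(a)). *)
pose x : Zadj a := ZAdj (Zval (d *: r)); pose y : Zadj a := ZAdj (Zval (c *: s)).
have xE : \val x = d%:~R * (map_poly intr r).[a] by rewrite /= map_polyZ hornerE.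
have yE : \val y = c%:~R * (map_poly intr s).[a] by rewrite /= map_polyZ hornerE.
exists x, y; split.
  rewrite -(inj_eq val_inj) yE rmorph0.
  by rewrite mulf_neq0 // nzC.
apply: val_inj; rewrite fmorph_div zE pE qE.
rewrite [X in _ = X / _]xE [X in _ = _ / X]yE.
by field; rewrite !nzC // nz_s.
Qed.

(** Cubing gives n^3 = 2 w^3, where w^3 is a rational algebraic integer, hence an integer; so n^3 is
    even, and so is n. *)
Lemma even_of_cbrt2_dvd (t : algC) (n a b : int) : t ^+ 3 = 2 ->
  n%:~R = t * (a%:~R + b%:~R * t) -> exists m : int, n = 2 * m.
Proof.
move=> t3 nE; set w := a%:~R + b%:~R * t in nE.
have At : t \in Aint.
  apply: (@root_monic_Aint ('X^3 - 2%:P)).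
  - by rewrite rootE !hornerE t3 subrr.
  - by rewrite monicXnsubC.
  - by rewrite polyOverXnsubC; exact: (natr_int algC 2).
have Aw : w ^+ 3 \in Aint by rewrite rpredX // rpredD ?rpredM ?Aint_int.
have nE3 : n%:~R ^+ 3 = 2 * w ^+ 3 :> algC by rewrite nE exprMn t3.
have nz2 : 2 != 0 :> algC by rewrite pnatr_eq0.
have Qw : w ^+ 3 \in Crat.
  have -> : w ^+ 3 = n%:~R ^+ 3 / 2 by rewrite nE3 mulrC mulKf.
  by rewrite rpred_div ?rpredX ?rpred_nat ?rpred_int.
have /intrP[k wE] := Cint_rat_Aint Qw Aw.
have n3 : n ^+ 3 = 2 * k by apply: (@intr_inj algC); rewrite rmorphXn rmorphM /= nE3 wE.
have : (2 %| n ^+ 3)%Z by rewrite n3 dvdz_mulr.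
rewrite dvdzE abszX Euclid_dvdX // andbT -dvdzE.
by case/dvdzP=> m ->; exists m; rewrite mulrC.
Qed.

Lemma Zadjoin_alphaP (x : algC) : x \in Zadjoin alpha ->
  exists a b c : int, x = a%:~R + b%:~R * alpha + c%:~R * alpha ^+ 2.
Proof.
case/ZadjoinP=> p ->; elim/poly_ind: p => [|p d [a [b [c pE]]]].
  by exists 0, 0, 0; rewrite rmorph0 horner0 !mul0r !addr0.
(* A Horner step multiplies by [alpha]; the cubic term folds back through alpha^3 = 16. *)
exists (16 * c + d), a, b.
rewrite rmorphD rmorphM /= map_polyX map_polyC !hornerE pE rmorphD rmorphM /=.
by rewrite -[16%:~R]/(16 : algC) -alphaX3; ring.
Qed.

(** A 2-adic descent in t = 2^(1/3): the integer term, once isolated, is t times an element of Z[t],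
    hence even. Dividing by 2 or by t and repeating ends with the odd number 1 - 2z being even. *)
Lemma half_alpha2_notin : alpha ^+ 2 / 2 \notin Zadjoin alpha.
Proof.
apply/negP=> /Zadjoin_alphaP[x [y [z xyz]]].
have t3 : (3.-root 2) ^+ 3 = 2 :> algC by rewrite rootCK.
rewrite alphaE in xyz; move: t3 xyz; set t := 3.-root 2 => t3 xyz.
have nz2 : 2 != 0 :> algC by rewrite pnatr_eq0.
have nz_t : t != 0.
  by apply: contra_eq_neq t3 => ->; rewrite expr0n eq_sym.
have {}xyz : 2 * t ^+ 2 = x%:~R + 2 * y%:~R * t + 4 * z%:~R * t ^+ 2.
  have -> : 2 * t ^+ 2 = (2 * t) ^+ 2 / 2 by field.
  by rewrite xyz; ring.
have [x1 xE] : exists m : int, x = 2 * m.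
  apply: (even_of_cbrt2_dvd t _ (- (2 * y)) (2 * (1 - 2 * z)) t3).
  rewrite !(rmorphM, rmorphN, rmorphB) /=.
  by apply: (addIr (2 * y%:~R * t + 4 * z%:~R * t ^+ 2)); rewrite addrA -xyz; ring.
have {}xyz : t ^+ 2 = x1%:~R + y%:~R * t + 2 * z%:~R * t ^+ 2.
  by apply: (mulfI nz2); rewrite xyz xE rmorphM /=; ring.
have [x2 x1E] : exists m : int, x1 = 2 * m.
  apply: (even_of_cbrt2_dvd t _ (- y) (1 - 2 * z) t3).
  rewrite !(rmorphM, rmorphN, rmorphB) /=.
  by apply: (addIr (y%:~R * t + 2 * z%:~R * t ^+ 2)); rewrite addrA -xyz; ring.
(* Since 2 = t^3, the even integer term is now divisible by t as well. *)
have {}xyz : t = x2%:~R * t ^+ 2 + y%:~R + 2 * z%:~R * t.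
  apply: (mulfI nz_t); rewrite -expr2 [LHS]xyz x1E rmorphM /=.
  transitivity (x2%:~R * t ^+ 3 + y%:~R * t + 2 * z%:~R * t ^+ 2); last by ring.
  by rewrite t3; ring.
have [y1 yE] : exists m : int, y = 2 * m.
  apply: (even_of_cbrt2_dvd t _ (1 - 2 * z) (- x2) t3).
  rewrite !(rmorphM, rmorphN, rmorphB) /=.
  apply: (addIr (x2%:~R * t ^+ 2 + 2 * z%:~R * t)).
  by rewrite addrCA addrA -xyz; ring.
have {}xyz : 1 = x2%:~R * t + y1%:~R * t ^+ 2 + 2 * z%:~R.
  apply: (mulfI nz_t); rewrite mulr1 [LHS]xyz yE rmorphM /=.
  transitivity (x2%:~R * t ^+ 2 + y1%:~R * t ^+ 3 + 2 * z%:~R * t); last by ring.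
  by rewrite t3; ring.
have [m] : exists m : int, 1 - 2 * z = 2 * m.
  apply: (even_of_cbrt2_dvd t _ x2 y1 t3).
  by rewrite rmorphB rmorphM rmorph1 /= {1}xyz; ring.
lia.
Qed.

(** The division-free form lives in Z[alpha], so it transports along any injective morphism to a
    field. *)
Lemma mul2_neq_alpha2 (w : Zalpha) : 2 * w != Zgen alpha ^+ 2.
Proof.
apply: contraNneq half_alpha2_notin => wE.
suff -> : alpha ^+ 2 / 2 = \val w by exact: valP.
have nz2 : 2 != 0 :> algC by rewrite pnatr_eq0.
by rewrite -[alpha]/(\val (Zgen alpha)) -rmorphXn -wE rmorphM rmorph_nat mulrC mulKf.
Qed.

Lemma Zgen_alphaX3 : Zgen alpha ^+ 3 = 16.
Proof. by apply: val_inj; rewrite rmorphXn rmorph_nat /= alphaX3. Qed.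

Lemma rank1_minor (F : comPzRingType) (m n : nat) (u : 'cV[F]_m) (v : 'rV[F]_n)
    (i k : 'I_m) (j l : 'I_n) :
  (u *m v) i j * (u *m v) k l = (u *m v) i l * (u *m v) k j.
Proof. by rewrite !mxE !big_ord1; ring. Qed.

(** * Matrices over Z[alpha] similar to A over a field *)

Section SimilarToA.
(** [F] stays abstract to cover both [Qalpha] and the formal field of fractions of [Zalpha]. *)
Variables (F : fieldType) (f : {rmorphism Zalpha -> F}) (B : 'M[Zalpha]_3).
Hypotheses (inj_f : injective f).
Hypotheses (simAB : Defs.similar (map_mx f matA) (map_mx f B)).

Let s : F := f (Zgen alpha ^+ 2) / 2.

Let nz2 : (2 : F) != 0.
Proof.
rewrite -(rmorph_nat f) -(rmorph0 f) (inj_eq inj_f) -(inj_eq val_inj).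
by rewrite rmorph_nat rmorph0 pnatr_eq0.
Qed.

Let nz4 : (4 : F) != 0.
Proof. by rewrite -[4]/(2 * 2)%:R natrM mulf_neq0. Qed.

Let nz8 : (8 : F) != 0.
Proof. by rewrite -[8]/(2 * 4)%:R natrM mulf_neq0. Qed.

Let s_notin (w : Zalpha) : f w <> s.
Proof.
move=> wE; have /eqP[] := mul2_neq_alpha2 w.
by apply: inj_f; rewrite rmorphM rmorph_nat wE mulrC divfK.
Qed.

Let minorB i j k l :
  (map_mx f B + s%:M) i j * (map_mx f B + s%:M) k l =
  (map_mx f B + s%:M) i l * (map_mx f B + s%:M) k j.
Proof.
have [g Ug gAB] := simAB.
pose a := f (Zgen alpha).
have a3 : a ^+ 3 = 16 by rewrite -rmorphXn Zgen_alphaX3 rmorph_nat.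
(* [field] cannot use a^3 = 16, so the entries 4 and 2a are rewritten as multiples of powers of
   a. *)
have e4 : 4 = a ^+ 3 / 4 by rewrite a3; field.
have e2a : 2 * a = a ^+ 4 / 8 by rewrite exprSr a3; field.
(* [v] is the first row of A + s I, and [u] lists the ratios of the rows to it. *)
pose u : 'cV[F]_3 := \col_i [:: 1; s / 2; a / 2]`_i.
pose v : 'rV[F]_3 := \row_j [:: s; 2; a]`_j.
have AE : map_mx f matA + s%:M = u *m v.
  apply/matrixP=> p q; rewrite !mxE big_ord1 !mxE /s rmorphXn -/a.
  case: p => [[|[|[|p]]] //= lt_p]; case: q => [[|[|[|q]]] //= lt_q];
    rewrite ?rmorph0 ?rmorphM ?rmorph_nat ?mulr1n ?mulr0n -?/a ?addr0.
  4: rewrite [LHS]e2a.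
  6-7: rewrite [LHS]e4.
  1-9: by field; rewrite ?nz2 ?nz4 ?nz8.
have -> : map_mx f B + s%:M = (g *m u) *m (v *m invmx g).
  (* The scalar matrix is fixed by conjugation, so only the factors [u] and [v] change. *)
  rewrite -gAB mulmxA -(mulmxA g u) -AE mulmxDr mulmxDl; congr (_ + _).
  by rewrite scalar_mxC -mulmxA mulmxV // mulmx1.
exact: rank1_minor.
Qed.

Let offdiagB i j : i != j -> (map_mx f B + s%:M) i j = f (B i j).
Proof. by rewrite !mxE => /negPf->; rewrite addr0. Qed.

Lemma similar_matA_diag : ~ has_diagonal B diag_1N10.
Proof.
pose i0 : 'I_3 := @Ordinal 3 0 isT; pose i2 : 'I_3 := @Ordinal 3 2 isT.
move=> dB; have := minorB i0 i0 i2 i2.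
rewrite (offdiagB i0 i2) // (offdiagB i2 i0) // !mxE !dB !eqxx /diag_1N10 /= rmorph1 rmorph0 add0r mulr1n.
move=> sE; apply: (s_notin (B i0 i2 * B i2 i0 - 4 * Zgen alpha)).
(* The square of s is alpha^4 / 4 = 4 alpha, so s + s^2 differs from s by an element of the image of
   Z[alpha]. *)
have s2 : s ^+ 2 = 4 * f (Zgen alpha).
  have a4 : f (Zgen alpha) ^+ 4 = 16 * f (Zgen alpha).
    by rewrite exprSr -rmorphXn Zgen_alphaX3 rmorph_nat.
  by rewrite /s rmorphXn expr_div_n -exprM a4; field.
by rewrite rmorphB !rmorphM rmorph_nat /= -sE -s2; ring.
Qed.

Lemma similar_matA_neq1 (i j : 'I_3) : i != j -> B i j <> 1.
Proof.
move=> ne_ij Bij.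
have [k /andP[ne_ki ne_kj]] : exists k : 'I_3, (k != i) && (k != j).
  (* Without a third index, the three indices would all lie in [[set i; j]]. *)
  apply/existsP; apply: contraT; rewrite negb_exists => /forallP cover.
  have : (#|'I_3| <= #|[set i; j]|)%N.
    apply/subset_leq_card/subsetP=> k _; rewrite !inE.
    by have := cover k; rewrite negb_and !negbK.
  by rewrite card_ord cards2; case: (_ != _).
have := minorB i j k k.
rewrite (offdiagB i j) // (offdiagB k j) // (offdiagB i k) 1?eq_sym //.
rewrite Bij rmorph1 mul1r !mxE eqxx mulr1n.
move=> sE; apply: (s_notin (B i k * B k j - B k k)).
by rewrite rmorphB rmorphM -sE /=; ring.
Qed.

End SimilarToA.

Lemma ZtoQ_inj : injective (@ZtoQ alpha).
Proof. by move=> x y /(congr1 \val) xy; apply: val_inj. Qed.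

Lemma matA_not_scalar : ~~ is_scalar_mx matA.
Proof.
apply/is_scalar_mxP=> -[c /matrixP/(_ (@Ordinal 3 0 isT) (@Ordinal 3 1 isT))].
rewrite !mxE /= mulr0n => /(congr1 \val)/eqP.
by rewrite rmorph_nat rmorph0 pnatr_eq0.
Qed.

Theorem proposition2p2 :
  (Qadjoin alpha =i Qadjoin (3.-root 2) /\
   (forall z : Qalpha, exists x y : Zalpha, y != 0 /\ z = ZtoQ x / ZtoQ y)) /\
  (~ exists B : 'M[Zalpha]_3,
       has_diagonal B diag_1N10 /\ similar_over_K matA B) /\
  ~ prescribed_diagonals Zalpha /\
  (~ exists B : 'M[Zalpha]_3,
       (exists i j : 'I_3, i != j /\ B i j = 1) /\ similar_over_K matA B).
Proof.
split; first split.
- move=> x; rewrite alphaE -[2 * _]/(2%:R * _) -(rmorph_nat ratr 2).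
  by rewrite Qadjoin_scale.
- exact: Qadj_fraction.
split=> [[B [dB simB]]|].
  exact: (similar_matA_diag _ _ B ZtoQ_inj simB dB).
split=> [prescr|[B [[i [j [ne_ij Bij]]] simB]]]; last first.
  exact: (similar_matA_neq1 _ _ B ZtoQ_inj simB i j ne_ij Bij).
(* A itself is the counterexample, with n = 3: both sums are 0. *)
have trE : \sum_i diag_1N10 i = \tr matA.
  rewrite /mxtrace !big_ord_recl !big_ord0 !mxE /diag_1N10 /=.
  by rewrite !addr0 subrr.
have [B [dB simB]] := prescr _ _ diag_1N10 isT matA_not_scalar trE.
(* Here similarity is over the formal field of fractions, so the section is applied to [tofrac]. *)
have inj_frac : injective (@tofrac Zalpha).
  by move=> x y /eqP; rewrite tofrac_eq => /eqP.
exact: (similar_matA_diag _ _ B inj_frac simB dB).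
Qed.
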